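(* Let $G_n^6$ be the ladder $P_2\square P_n$, i.e. the graph with vertices $v_i,w_i$ ($i=1,\dots,n$) and edges $v_iv_{i+1},w_iw_{i+1}$ ($i=1,\dots,n-1$) and $v_iw_i$ ($i=1,\dots,n$). Then $$\lim_{n\to\infty}\mathcal{I}(G_n^6)=\frac{2r^4-r^2+3r+4}{2r^4+4r+5},\qquad r=\frac13\Big(1+\sqrt[3]{\tfrac{47+3\sqrt{93}}{2}}+\sqrt[3]{\tfrac{47-3\sqrt{93}}{2}}\Big).$$
   Context: For a finite simple graph $G$: a matching is a set of pairwise vertex-disjoint edges; it is maximal if not contained in a larger matching. $\nu(G)$ is the maximum matching size, $\mathcal{T}_0(G)$ the number of maximal matchings, $\mathcal{T}_1(G)$ the sum of the sizes of all maximal matchings, and $\mathcal{I}(G)=\frac{\mathcal{T}_1(G)}{\nu(G)\mathcal{T}_0(G)}$ (equal to $1$ by convention if $\nu(G)=0$). *)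

(* Defs.v *)
From HB Require Import structures.
From mathcomp Require Import all_boot all_order all_algebra.
From mathcomp Require Import reals.

Set Implicit Arguments.
Unset Strict Implicit.
Unset Printing Implicit Defensive.

Record sgraph := SGraph {
  vertex : finType;
  adj : rel vertex;
  adj_sym : symmetric adj;
  adj_irrefl : irreflexive adj }.

(* An edge is the two-element set of its endpoints. *)
Definition edges (G : sgraph) : {set {set vertex G}} :=
  [set e : {set vertex G} |
    [exists x, exists y, adj x y && (e == [set x; y])]].

Definition matching (G : sgraph) (M : {set {set vertex G}}) : bool :=
  (M \subset edges G) && trivIset M.

Definition maximal_matchings (G : sgraph) : {set {set {set vertex G}}} :=
  [set M : {set {set vertex G}} | maxset (@matching G) M].

Definition nu (G : sgraph) : nat :=
  \max_(M : {set {set vertex G}} | matching M) #|M|.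

Definition T0 (G : sgraph) : nat := #|maximal_matchings G|.

Definition T1 (G : sgraph) : nat := \sum_(M in maximal_matchings G) #|M|.

Definition avgI (R : realType) (G : sgraph) : R :=
  if nu G == 0 then 1%R else ((T1 G)%:R / ((nu G)%:R * (T0 G)%:R))%R.

(* The vertices (false, i) and (true, i), for i = 0, ..., n - 1, are the
   v_(i+1) and w_(i+1) of the ladder. *)
Definition ladder_adj (n : nat) : rel (bool * 'I_n) := fun x y =>
  ((x.1 == y.1) && ((x.2.+1 == y.2 :> nat) || (y.2.+1 == x.2 :> nat)))
  || ((x.1 != y.1) && (x.2 == y.2)).

Lemma ladder_adj_sym n : symmetric (@ladder_adj n).
Proof.
move=> x y; rewrite /ladder_adj [y.1 == x.1]eq_sym [y.2 == x.2]eq_sym.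
by rewrite [X in _ && X || _]orbC.
Qed.

Lemma ladder_adj_irrefl n : irreflexive (@ladder_adj n).
Proof. by move=> x; rewrite /ladder_adj !eqxx /= orbF orbb gtn_eqF. Qed.

Definition ladder (n : nat) : sgraph :=
  SGraph (@ladder_adj_sym n) (@ladder_adj_irrefl n).

(* Main.v *)
(* A set of edges of the ladder is a word over the eight possible columns (rung,
   two horizontal edges to the next column), and being a maximal matching is a
   condition on three consecutive columns.  A transfer matrix with five states
   up to swapping the rows therefore counts maximal matchings: their number a_n
   satisfies P(S) a = 0 for the shift S and P = z^5 - 2 z^4 - z - 1, and their
   total size b_n satisfies P(S) b = (2 S^4 - S^2 + 3 S + 4) a.  Here
   P = (z - r) Q where the roots of Q have modulus at most 1 < r, so a_n / r^n
   converges to some c > 0, and b_(n+1) / r^(n+1) - b_n / r^n converges to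
   c (2 r^4 - r^2 + 3 r + 4) / (r P'(r)).  By Cesaro the same holds for
   b_n / (n r^n); since nu = n, and r P'(r) = 2 r^4 + 4 r + 5, this is the
   claim. *)
Require Import Defs.
From HB Require Import structures.
From mathcomp Require Import all_boot all_order all_algebra.
From mathcomp Require Import ring lra zify.

(** * Maximal matchings of the ladder as words *)

(** An edge disjoint from the cover could be added. Conversely, each edge of a larger matching meets
    some edge of [M], and disjointness inside the larger matching makes the two equal. *)
Lemma maximal_matchingP (G : sgraph) (M : {set {set vertex G}}) :
  reflect (matching M /\ forall e, e \in edges G -> ~~ [disjoint e & cover M])
          (maxset (@matching G) M).
Proof.
have edge_n0 e : e \in edges G -> e != set0.
  rewrite inE => /existsP[x /existsP[y /andP[_ /eqP->]]].
  by apply/set0Pn; exists x; rewrite set21.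
apply: (iffP maxsetP) => -[mM HM]; split=> //.
- move=> e eG; apply/negP => dis; have /andP[ME tM] := mM.
  have e0 := edge_n0 _ eG.
  have eM : e \in M.
    rewrite -(HM (e |: M)) ?setU11 ?subsetUr // /matching subUset sub1set eG ME.
    rewrite /= trivIsetU // /trivIset /cover ?big_set1 //.
  have /set0Pn[x xe] := e0; move/pred0P/(_ x): dis.
  by rewrite /= xe /=; case/bigcupP; exists e.
- move=> B /andP[BG tB] MB; apply/eqP; rewrite eqEsubset MB andbT; apply/subsetP => e eB.
  have /pred0Pn[x /= /andP[xe /bigcupP[f fM xf]]] := HM _ (subsetP BG _ eB).
  case: (eqVneq e f) => [->//|nef].
  have /pred0P/(_ x) := trivIsetP tB _ _ eB (subsetP MB _ fM) nef.
  by rewrite /= xe xf.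
Qed.

Definition column := (bool * bool * bool)%type.
Definition has_rung (c : column) : bool := c.1.1.
Definition has_hor (b : bool) (c : column) : bool := if b then c.2 else c.1.2.
Definition empty_column : column := (false, false, false).
Definition rung_column : column := (true, false, false).

Definition column_size (c : column) : nat :=
  has_rung c + has_hor false c + has_hor true c.

Definition col_covers (b : bool) (q c : column) : bool :=
  [|| has_hor b q, has_rung c | has_hor b c].

Definition at_most_one (x y z : bool) : bool :=
  [&& ~~ (x && y), ~~ (x && z) & ~~ (y && z)].

(** The conditions read off at [c]: disjointness at its vertices, a covered endpoint for each
    horizontal edge arriving from the column of [q], and one for its rung. Column [p] enters through
    the horizontal edges that cover vertices of [q]. *)
Definition locally_maximal (p q c : column) : bool :=
  [&& [forall b, at_most_one (has_hor b q) (has_rung c) (has_hor b c)],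
      [forall b, col_covers b p q || col_covers b q c]
    & col_covers false q c || col_covers true q c].

(* [hF] and [hT] say whether rows [false] and [true] receive a horizontal edge
   from the previous column, [cF] and [cT] whether the vertices of that column
   are covered. *)
Fixpoint accepts (hF hT cF cT : bool) (s : seq column) : bool :=
  if s is (x, f, t) :: s' then
    let dF := [|| hF, x | f] in
    let dT := [|| hT, x | t] in
    [&& at_most_one hF x f, at_most_one hT x t, cF || dF, cT || dT, dF || dT
      & accepts f t dF dT s']
  else ~~ hF && ~~ hT.

(** The four flags retain all that the conditions at the next column need from [p] and [q]. *)
Lemma acceptsP p q s :
  reflect ((forall k, k < size s ->
      locally_maximal (nth empty_column [:: p, q & s] k)
        (nth empty_column [:: p, q & s] k.+1)
        (nth empty_column [:: p, q & s] k.+2))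
    /\ forall b, ~~ has_hor b (last q s))
  (accepts (has_hor false q) (has_hor true q)
     (col_covers false p q) (col_covers true p q) s).
Proof.
elim: s p q => [|c s IH] p q.
  apply: (iffP andP) => [[h1 h2]|[_ h]]; first by split=> // -[].
  by split; apply: h.
have -> : accepts (has_hor false q) (has_hor true q)
     (col_covers false p q) (col_covers true p q) (c :: s) =
   locally_maximal p q c && accepts (has_hor false c) (has_hor true c)
     (col_covers false q c) (col_covers true q c) s.
  have fb (P : pred bool) : [forall b, P b] = P false && P true.
    by apply/forallP/andP => [h|[h1 h2] []//]; split; apply: h.
  rewrite /locally_maximal !fb; case: c => [[x f] t] /=.
  rewrite /col_covers /has_rung /has_hor /=; by rewrite !andbA.
apply: (iffP andP) => [[h0 /IH[h1 h2]]|[h1 h2]].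
  by split=> // -[|k] //= /h1.
split; first exact: (h1 0).
by apply/IH; split=> // k hk; apply: (h1 k.+1).
Qed.

(** * Edge sets of the ladder as words of columns *)

Section Ladder.
Variable n : nat.
Implicit Types (t : n.-tuple column) (x : bool * 'I_n).

(* [(None, i)] stands for the rung of column [i] and [(Some b, i)] for the edge
   of row [b] from column [i] to column [i + 1]; in the last column the latter
   is a singleton, hence not an edge. *)
Definition slot_set (p : option bool * 'I_n) : {set bool * 'I_n} :=
  if p.1 is Some b then
    [set x | (x.1 == b) && ((x.2 == p.2) || (x.2 == p.2.+1 :> nat))]
  else [set x | x.2 == p.2].

Definition selects (o : option bool) (c : column) : bool :=
  if o is Some b then has_hor b c else has_rung c.

Definition valid_slot (p : option bool * 'I_n) : bool :=
  (p.1 == None) || (p.2.+1 < n).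

Lemma slot_set_inj : injective slot_set.
Proof.
move=> [o i] [o' j] /setP E; congr pair; last first.
  (* The starting vertex of each slot lies in the other slot; being off by one cannot happen both
     ways. *)
  have := E (odflt false o, i); have := E (odflt false o', j).
  rewrite /slot_set; case: o {E} => [b|]; case: o' => [b'|];
    rewrite !inE /= !eqxx /= ?orbT -?(inj_eq val_inj) /=.
  - move=> /andP[_ /orP[/eqP/val_inj//|/eqP e1]].
    move=> /esym/andP[_ /orP[/eqP/val_inj//|/eqP e2]]; lia.
  - by move=> _ /esym/eqP/val_inj.
  - by move=> /eqP/val_inj.
  - by move=> /eqP/val_inj.
have := E (false, i); have := E (true, i).
have := E (false, j); have := E (true, j).
by rewrite /slot_set; case: o {E} => [[]|]; case: o' => [[]|] //;
  rewrite !inE /= ?eqxx //= => *; lia.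
Qed.

Lemma ladder_edgeP (e : {set bool * 'I_n}) :
  reflect (exists2 p, valid_slot p & e = slot_set p) (e \in edges (ladder n)).
Proof.
rewrite inE; apply: (iffP existsP) => [[x /existsP[y /andP[]]]|].
  have hor b (i j : 'I_n) : i.+1 = j ->
      [set (b, i); (b, j)] = slot_set (Some b, i).
    move=> ij; apply/setP=> -[c k]; rewrite /slot_set !inE /= !xpair_eqE.
    by rewrite -andb_orr -(inj_eq val_inj k j) ij.
  case: x y => [b i] [c j] /orP[/andP[/= /eqP<- /orP[]/eqP ij]|] /eqP.
  - by move=> ->; exists (Some b, i); [rewrite /valid_slot /= ij | apply: hor].
  - move=> ->; exists (Some b, j); first by rewrite /valid_slot /= ij.
    by rewrite setUC; apply: hor.
  - move=> /eqP/andP[/= bc /eqP<-] /eqP->; exists (None, i) => //.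
    apply/setP=> -[d k]; rewrite /slot_set !inE /= !xpair_eqE -andb_orl.
    by case: b c d bc => [] [] [].
move=> [[[b|] i] /= v ->]; last first.
  exists (false, i); apply/existsP; exists (true, i).
  rewrite /ladder_adj /= eqxx /=; apply/eqP/setP=> -[d k].
  by rewrite /slot_set !inE /= !xpair_eqE -andb_orl; case: d.
exists (b, i); apply/existsP; exists (b, Ordinal v).
rewrite /ladder_adj /= !eqxx /=; apply/eqP/setP=> -[d k].
rewrite /slot_set !inE /= !xpair_eqE -andb_orr; congr (_ && (_ || _)).
Qed.

Definition decode t : {set {set bool * 'I_n}} :=
  [set slot_set p | p in [pred p | selects p.1 (tnth t p.2)]].

Definition encode (M : {set {set bool * 'I_n}}) : n.-tuple column :=
  [tuple (slot_set (None, i) \in M, slot_set (Some false, i) \in M,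
          slot_set (Some true, i) \in M) | i < n].

Lemma mem_decode t p : (slot_set p \in decode t) = selects p.1 (tnth t p.2).
Proof. by rewrite mem_imset //; exact: slot_set_inj. Qed.

(** The singletons in the last column make this hold for every word, not only for those that code
    sets of edges. *)
Lemma decodeK : cancel decode encode.
Proof.
move=> t; apply: eq_from_tnth => i; rewrite tnth_mktuple !mem_decode /=.
by case: (tnth t i) => [[]].
Qed.

Lemma selects_encode (M : {set {set bool * 'I_n}}) p : selects p.1 (tnth (encode M) p.2) = (slot_set p \in M).
Proof. by case: p => [[[]|] i]; rewrite tnth_mktuple. Qed.

Lemma encodeK (M : {set {set bool * 'I_n}}) : M \subset edges (ladder n) -> decode (encode M) = M.
Proof.
move=> /subsetP ME; apply/setP=> e; apply/imsetP/idP => [[p]|eM].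
  by rewrite inE selects_encode => pM ->.
have /ladder_edgeP[p _ ep] := ME _ eM; exists p => //.
by rewrite inE selects_encode -ep.
Qed.

Lemma card_decode t :
  #|decode t| = \sum_(c <- t) column_size c.
Proof.
rewrite card_imset; last exact: slot_set_inj.
rewrite -sum1_card big_mkcond /=.
rewrite -(pair_bigA _ (fun o i => if selects o (tnth t i) then 1 else 0)) /=.
rewrite exchange_big big_tuple; apply: eq_bigr => i _ /=.
rewrite (bigD1 None) //= (bigD1 (Some false)) //= (bigD1 (Some true)) //=.
rewrite big1 ?addn0 => [|[[]|]//].
by case: (tnth t i) => [[[] []] []].
Qed.

(* The rung in front of the first column covers both rows, so that it imposes no
   constraint on that column. *)
Definition padded t : nat -> column :=
  nth empty_column [:: empty_column, rung_column & t].

Lemma padded_tnth t (i : 'I_n) : padded t i.+2 = tnth t i.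
Proof. by rewrite (tnth_nth empty_column). Qed.

(** Before the first column stands the padding rung, which selects no horizontal edge. *)
Lemma padded_prevP t b (i : 'I_n) :
  reflect (exists2 j : 'I_n, i = j.+1 :> nat & has_hor b (tnth t j))
          (has_hor b (padded t i.+1)).
Proof.
apply: (iffP idP) => [|[j -> hj]]; last by rewrite padded_tnth.
case: i => [[|i] /= ilt]; first by case: b.
by move=> h; exists (Ordinal (ltnW ilt)); rewrite // -padded_tnth.
Qed.

Lemma in_slotP x p :
  reflect [\/ p = (None, x.2), p = (Some x.1, x.2)
            | p.1 = Some x.1 /\ x.2 = p.2.+1 :> nat]
          (x \in slot_set p).
Proof.
case: x p => b i [[c|] j]; rewrite !inE /=; last first.
  by apply: (iffP eqP) => [->|[[]|//|[]]//]; constructor.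
apply: (iffP andP) => [[/eqP<- /orP[/eqP<-|/eqP]]|]; try by constructor.
by case=> [//|[-> ->]|[[->] ->]]; rewrite !eqxx ?orbT.
Qed.

Lemma mem_cover_decode t x :
  (x \in cover (decode t))
  = col_covers x.1 (padded t x.2.+1) (padded t x.2.+2).
Proof.
rewrite /col_covers padded_tnth; apply/bigcupP/or3P.
  move=> [e /imsetP[p]]; rewrite inE => sp -> /in_slotP xp.
  case: xp sp => [->|->|[e1 e2]] /= sp; [exact: Or32|exact: Or33|apply: Or31].
  by apply/padded_prevP; exists p.2 => //; rewrite e1 in sp.
case=> [/padded_prevP[j ij hj]|h|h].
- by exists (slot_set (Some x.1, j)); rewrite ?mem_decode //; apply/in_slotP/Or33.
- by exists (slot_set (None, x.2)); rewrite ?mem_decode //; apply/in_slotP/Or31.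
- by exists (slot_set (Some x.1, x.2)); rewrite ?mem_decode //; apply/in_slotP/Or32.
Qed.

(** Distinct selected slots that share a vertex are two of the three possible ones there: from the
    left, the rung, to the right. *)
Lemma trivIset_decodeP t :
  reflect (forall x, at_most_one (has_hor x.1 (padded t x.2.+1))
             (has_rung (padded t x.2.+2)) (has_hor x.1 (padded t x.2.+2)))
          (trivIset (decode t)).
Proof.
apply: (iffP trivIsetP) => [tM x|H A B /imsetP[p + ->] /imsetP[q + ->] neq].
  have uniq_slot p q : selects p.1 (tnth t p.2) -> selects q.1 (tnth t q.2) ->
      x \in slot_set p -> x \in slot_set q -> p = q.
    rewrite -!mem_decode => sp sq xp xq; apply/eqP/negPn/negP => npq.
    have /pred0P/(_ x) : [disjoint slot_set p & slot_set q].
      by apply: tM => //; apply: contra npq => /eqP/slot_set_inj->.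
    by rewrite /= xp xq.
  have rP : x \in slot_set (None, x.2) by apply/in_slotP/Or31.
  have hP : x \in slot_set (Some x.1, x.2) by apply/in_slotP/Or32.
  have pP (j : 'I_n) : x.2 = j.+1 :> nat -> x \in slot_set (Some x.1, j).
    by move=> ij; apply/in_slotP/Or33.
  rewrite padded_tnth; apply/and3P; split; apply/negP => /andP[].
  - move=> /padded_prevP[j ij hj] hr.
    by have := uniq_slot (Some x.1, j) (None, x.2) hj hr (pP j ij) rP.
  - move=> /padded_prevP[j ij hj] hr.
    have [jx] := uniq_slot (Some x.1, j) (Some x.1, x.2) hj hr (pP j ij) hP.
    by move: ij; rewrite jx => /eqP; rewrite ltn_eqF.
  - by move=> hr hh; have := uniq_slot (None, x.2) (Some x.1, x.2) hr hh rP hP.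
rewrite !inE => sp sq; apply/pred0Pn => -[x /= /andP[/in_slotP xp /in_slotP xq]].
have prev u : selects u.1 (tnth t u.2) -> u.1 = Some x.1 ->
    x.2 = u.2.+1 :> nat -> has_hor x.1 (padded t x.2.+1).
  by move=> su u1 u2; apply/padded_prevP; exists u.2 => //; rewrite u1 in su.
have := H x; rewrite padded_tnth => /and3P[].
case: xp xq sp sq neq => [->|->|[p1 p2]] [->|->|[q1 q2]] /= sp sq;
  rewrite ?eqxx // ?sp ?sq //= ?(prev _ sp p1 p2) ?(prev _ sq q1 q2) ?andbF //=.
(* Only the case is left in which both slots reach [x] from the left, hence from the same column. *)
case: p q p1 p2 q1 q2 {sp sq} => [p1 p2] [q1 q2] /= -> e1 -> e2.
have -> : p2 = q2 by apply/val_inj => /=; lia.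
by rewrite eqxx.
Qed.

(** Only the horizontal slots of the last column fail to be edges. For [n = 0] the default
    [rung_column] selects none. *)
Lemma decode_edges t :
  (decode t \subset edges (ladder n))
  = [forall b, ~~ has_hor b (last rung_column t)].
Proof.
apply/subsetP/forallP => [sub b|H e /imsetP[p]].
  apply/negP; rewrite -nth_last size_tuple => h.
  case: (posnP n) => [n0|n_gt0].
    by move: h; rewrite nth_default ?size_tuple ?n0 //; case: b.
  have nlt : n.-1 < n by rewrite prednK.
  have : slot_set (Some b, Ordinal nlt) \in decode t.
    by rewrite mem_decode (tnth_nth rung_column).
  move=> /sub/ladder_edgeP[q vq /slot_set_inj eq].
  by move: vq; rewrite -eq /valid_slot /= prednK // ltnn.
rewrite inE => sp ->; apply/ladder_edgeP; exists p => //.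
case: p sp => [[b|//] i] /= hi; rewrite /valid_slot /= ltnNge; apply/negP => ni.
have := H b; rewrite -nth_last size_tuple.
have -> : n.-1 = i by have := ltn_ord i; lia.
by rewrite -tnth_nth hi.
Qed.

(** The initial flags are those of the two padding columns, so [acceptsP] gives local conditions at
    every column; these amount to disjointness and to the covering criterion of
    [maximal_matchingP]. *)
Lemma maximal_decode t :
  maxset (@matching (ladder n)) (decode t) = accepts false false true true t.
Proof.
pose ok := @acceptsP empty_column rung_column t.
apply/maximal_matchingP/ok; rewrite size_tuple -/(padded t).
  move=> [/andP[]]; rewrite decode_edges => /forallP lastt /trivIset_decodeP tri H.
  split=> // k kn; pose i := Ordinal kn.
  apply/and3P; split.
  - by apply/forallP => b; apply: (tri (b, i)).
  - apply/forallP => b; case: k kn @i => [|k] kn i.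
      by rewrite /col_covers /= orbT.
    pose j := Ordinal (ltnW kn).
    have /H/pred0Pn[x /= /andP[/in_slotP xj]] :
        slot_set (Some b, j) \in edges (ladder n).
      by apply/ladder_edgeP; exists (Some b, j).
    rewrite mem_cover_decode.
    by case: xj => [//|[-> <-] /= ->//|/=[[->] ->] ->]; rewrite orbT.
  - have /H/pred0Pn[x /= /andP[/in_slotP xi]] :
        slot_set (None, i) \in edges (ladder n).
      by apply/ladder_edgeP; exists (None, i).
    rewrite mem_cover_decode.
    by case: xi => [[<-]|//|[]//] /=; case: (x.1) => ->; rewrite ?orbT.
move=> [H lastt]; split.
  rewrite /matching decode_edges; apply/andP; split; first exact/forallP.
  apply/trivIset_decodeP => x.
  by have /and3P[/forallP/(_ x.1)] := H x.2 (ltn_ord _).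
move=> e /ladder_edgeP[[[b|] i] v ->]; apply/pred0Pn => /=; last first.
  have /and3P[_ _ /orP[]c] := H i (ltn_ord i).
    exists (false, i); rewrite mem_cover_decode c andbT; exact/in_slotP/Or31.
  exists (true, i); rewrite mem_cover_decode c andbT; exact/in_slotP/Or31.
have /and3P[_ /forallP/(_ b)/orP[]c _] := H _ v.
  exists (b, i); rewrite mem_cover_decode c andbT; exact/in_slotP/Or32.
exists (b, Ordinal v); rewrite mem_cover_decode c andbT; exact/in_slotP/Or33.
Qed.

(** The weight [F] serves both [T0], as a constant, and [T1], as the identity. *)
Lemma sum_maximal_matchings (F : nat -> nat) :
  \sum_(M in maximal_matchings (ladder n)) F #|M|
  = \sum_(t : n.-tuple column | accepts false false true true t)
      F (\sum_(c <- t) column_size c).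
Proof.
rewrite (reindex_onto decode encode) => [|M]; last first.
  by rewrite inE => /maxsetp/andP[/encodeK].
apply: eq_big => t; first by rewrite inE maximal_decode decodeK eqxx andbT.
by rewrite card_decode.
Qed.

(** Each edge of a matching uses two of the [2n] vertices, and all the rungs together form a
    matching. *)
Lemma nu_ladder : nu (ladder n) = n.
Proof.
apply/eqP; rewrite eqn_leq; apply/andP; split.
  apply/bigmax_leqP => M /andP[ME tM].
  have : \sum_(B in M) #|B| <= n.*2.
    rewrite (eqP tM) (leq_trans (max_card _)) //.
    by rewrite card_prod card_bool card_ord mul2n.
  rewrite (eq_bigr (fun=> 2)) => [|B /(subsetP ME)].
    by rewrite sum_nat_const muln2 leq_double.
  rewrite inE => /existsP[x /existsP[y /andP[xy /eqP->]]].
  rewrite cards2; case: eqVneq xy => // ->; by rewrite adj_irrefl.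
pose t : n.-tuple column := [tuple rung_column | i < n].
have tn (i : 'I_n) : tnth t i = rung_column by rewrite tnth_mktuple.
have mt : @matching (ladder n) (decode t).
  rewrite /matching decode_edges; apply/andP; split.
    apply/forallP => b; rewrite -nth_last size_tuple.
    case: (ltnP n.-1 n) => h; last by rewrite nth_default ?size_tuple //; case: b.
    by rewrite -[n.-1]/(val (Ordinal h)) -tnth_nth tn; case: b.
  apply/trivIset_decodeP => -[b i] /=; rewrite padded_tnth tn.
  case: padded_prevP => [[j _]|_]; rewrite ?tn; by case: b.
apply: leq_trans (leq_bigmax_cond _ mt).
rewrite card_decode big_tuple (eq_bigr (fun=> 1)) => [|i _]; last by rewrite tn.
by rewrite sum1_card card_ord.
Qed.
End Ladder.

(** * The transfer matrix *)

Lemma sum_tupleS k (F : seq column -> nat) :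
  \sum_(t : k.+1.-tuple column) F t
  = \sum_(c : column) \sum_(t : k.-tuple column) F (c :: t).
Proof.
rewrite pair_bigA /=.
rewrite (reindex (fun p : column * k.-tuple column => [tuple of p.1 :: p.2])) //=.
exists (fun t => (thead t, [tuple of behead t])) => [[c t] _|t _] /=.
  by congr pair; apply/val_inj.
by rewrite [RHS]tuple_eta; apply/val_inj.
Qed.

Lemma sum_column (F : column -> nat) :
  \sum_(c : column) F c = \sum_x \sum_f \sum_t F (x, f, t).
Proof.
rewrite pair_bigA pair_bigA /=; apply: eq_bigr => -[[x f] t] _ //.
Qed.

Definition accept_sum (F : nat -> nat) k (hF hT cF cT : bool) : nat :=
  \sum_(t : k.-tuple column | accepts hF hT cF cT t)
    F (\sum_(c <- t) column_size c).

Lemma accept_sumS F k hF hT cF cT :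
  accept_sum F k.+1 hF hT cF cT = \sum_(x : bool) \sum_(f : bool) \sum_(t : bool)
    if [&& at_most_one hF x f, at_most_one hT x t, cF || [|| hF, x | f],
           cT || [|| hT, x | t] & [|| hF, x | f] || [|| hT, x | t]]
    then accept_sum (fun m => F (x + f + t + m)) k f t
           [|| hF, x | f] [|| hT, x | t]
    else 0.
Proof.
rewrite /accept_sum big_mkcond /=.
rewrite (sum_tupleS k (fun s => if accepts hF hT cF cT s
  then F (\sum_(c <- s) column_size c) else 0)) sum_column.
apply: eq_bigr => x _; apply: eq_bigr => f _; apply: eq_bigr => t _.
rewrite [in RHS]big_mkcond; case: ifP => [/and5P[h1 h2 h3 h4 h5]|nh].
  by apply: eq_bigr => s _ /=; rewrite h1 h2 h3 h4 h5 big_cons.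
by rewrite big1 // => s _ /=; rewrite !andbA in nh *; rewrite nh.
Qed.

Lemma accept_sum0 F hF hT cF cT :
  accept_sum F 0 hF hT cF cT = if hF || hT then 0 else F 0.
Proof.
rewrite /accept_sum big_mkcond /= (bigD1 [tuple]) //= big_nil big1 ?addn0.
  by case: hF hT => [] [].
by move=> t /negP[]; apply/eqP/val_inj; case: t => [[]].
Qed.

Lemma eq_accept_sum F G k hF hT cF cT :
  F =1 G -> accept_sum F k hF hT cF cT = accept_sum G k hF hT cF cT.
Proof. by move=> FG; apply: eq_bigr => t _; rewrite FG. Qed.

Lemma accept_sum_swap F k hF hT cF cT :
  accept_sum F k hF hT cF cT = accept_sum F k hT hF cT cF.
Proof.
elim: k F hF hT cF cT => [|k IH] F hF hT cF cT.
  by rewrite !accept_sum0 orbC.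
rewrite !accept_sumS; apply: eq_bigr => x _; rewrite exchange_big /=.
apply: eq_bigr => t _; apply: eq_bigr => f _.
rewrite IH andbCA [X in _ && (_ && X)]andbCA.
rewrite [X in _ && (_ && (_ && (_ && X)))]orbC.
by case: ifP => // _; apply: eq_accept_sum => m; rewrite [(_ + f + _)%N]addnAC.
Qed.

Definition num_states k := accept_sum (fun=> 1) k.
Definition size_states k := accept_sum id k.

Lemma accept_sum_addn m k hF hT cF cT :
  accept_sum (addn m) k hF hT cF cT
  = size_states k hF hT cF cT + m * num_states k hF hT cF cT.
Proof.
rewrite /size_states /num_states /accept_sum big_split big_distrr addnC /=.
by congr addn; apply: eq_bigr => t _; rewrite muln1.
Qed.

(* The letters record the state of a vertex of the previous column: [h] for
   matched to the right, [c] for covered without being matched to the right,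
   [u] for uncovered; a swap of the rows identifies [hc] with [ch], and so on. *)
Definition num_cc k := num_states k false false true true.
Definition num_cu k := num_states k false false true false.
Definition num_hc k := num_states k true false true true.
Definition size_cc k := size_states k false false true true.
Definition size_cu k := size_states k false false true false.
Definition size_hc k := size_states k true false true true.

Lemma accept_sum_hh F k :
  accept_sum F k.+1 true true true true = accept_sum F k false false true true.
Proof. by rewrite accept_sumS !big_bool /= !add0n. Qed.

(** The uncovered vertex forces a horizontal edge in its row, as the rung is blocked by the edge
    arriving in the other row. *)
Lemma accept_sum_hu F k :
  accept_sum F k.+1 true false true false
  = accept_sum (fun m => F (1 + m)) k true false true true.
Proof. by rewrite accept_sumS !big_bool /= !add0n !addn0 accept_sum_swap. Qed.

Lemma accept_sum_hc F k :
  accept_sum F k.+1 true false true true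
  = accept_sum (fun m => F (1 + m)) k true false true true
    + accept_sum F k false false true false.
Proof.
by rewrite accept_sumS !big_bool /= !add0n [X in X + _ = _]accept_sum_swap.
Qed.

(** From [cc] the column is a rung, two horizontal edges (state [hh]) or one (state [hu], in two
    ways); an empty column would leave its rung uncovered. The moves out of [hh] and [hu] are
    forced, so a second step eliminates these states. *)
Lemma accept_sum_cc F k :
  accept_sum F k.+2 false false true true
  = accept_sum (fun m => F (1 + m)) k.+1 false false true true
    + accept_sum (fun m => F (2 + m)) k false false true true
    + 2 * accept_sum (fun m => F (2 + m)) k true false true true.
Proof.
rewrite [LHS]accept_sumS !big_bool /= !addn0 !add0n.
rewrite (accept_sum_swap _ _ false true false true) accept_sum_hh !accept_sum_hu.
by rewrite mul2n -addnn !addnA.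
Qed.

(** A single horizontal edge must now lie in the row of the uncovered vertex, so the factor 2
    disappears. *)
Lemma accept_sum_cu F k :
  accept_sum F k.+2 false false true false
  = accept_sum (fun m => F (1 + m)) k.+1 false false true true
    + accept_sum (fun m => F (2 + m)) k false false true true
    + accept_sum (fun m => F (2 + m)) k true false true true.
Proof.
rewrite [LHS]accept_sumS !big_bool /= !addn0 !add0n.
rewrite (accept_sum_swap _ _ false true false true).
by rewrite accept_sum_hh accept_sum_hu addnA.
Qed.

(** * Linear recurrences for counts and total sizes *)

Lemma num_ccS k : num_cc k.+2 = num_cc k.+1 + num_cc k + 2 * num_hc k.
Proof. exact: accept_sum_cc. Qed.

Lemma num_cuS k : num_cu k.+2 = num_cc k.+1 + num_cc k + num_hc k.
Proof. exact: accept_sum_cu. Qed.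

Lemma num_hcS k : num_hc k.+1 = num_hc k + num_cu k.
Proof. exact: accept_sum_hc. Qed.

Lemma size_ccS k :
  size_cc k.+2 = size_cc k.+1 + num_cc k.+1 + (size_cc k + 2 * num_cc k)
                 + 2 * (size_hc k + 2 * num_hc k).
Proof.
rewrite /size_cc /size_states accept_sum_cc !(accept_sum_addn 1).
by rewrite !(accept_sum_addn 2) mul1n.
Qed.

Lemma size_cuS k :
  size_cu k.+2 = size_cc k.+1 + num_cc k.+1 + (size_cc k + 2 * num_cc k)
                 + (size_hc k + 2 * num_hc k).
Proof.
rewrite /size_cu /size_states accept_sum_cu !(accept_sum_addn 1).
by rewrite !(accept_sum_addn 2) mul1n.
Qed.

Lemma size_hcS k : size_hc k.+1 = size_hc k + num_hc k + size_cu k.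
Proof.
by rewrite /size_hc /size_states accept_sum_hc !(accept_sum_addn 1) mul1n.
Qed.

Lemma num_init :
  [/\ num_cc 0 = 1, num_cc 1 = 1, num_cu 0 = 1, num_cu 1 = 1 & num_hc 0 = 0].
Proof.
rewrite /num_cc /num_cu /num_hc /num_states.
by split; rewrite ?accept_sumS ?big_bool /= !accept_sum0.
Qed.

Lemma T0_ladder n : T0 (ladder n) = num_cc n.
Proof. by rewrite /T0 -sum1_card (sum_maximal_matchings n (fun=> 1)). Qed.

Lemma T1_ladder n : T1 (ladder n) = size_cc n.
Proof. exact: (sum_maximal_matchings n id). Qed.

Lemma num_cc_rec k : num_cc k.+4.+1 = 2 * num_cc k.+4 + num_cc k.+1 + num_cc k.
Proof.
have := num_ccS k; have := num_ccS k.+1.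
have := num_ccS k.+2; have := num_ccS k.+3.
have := num_cuS k; have := num_hcS k.
have := num_hcS k.+1; have := num_hcS k.+2.
lia.
Qed.

(** The forcing term with a minus sign stands on the left, away from truncated subtraction. *)
Lemma size_cc_rec k :
  size_cc k.+4.+1 + num_cc k.+2
  = 2 * size_cc k.+4 + size_cc k.+1 + size_cc k
    + (2 * num_cc k.+4 + 3 * num_cc k.+1 + 4 * num_cc k).
Proof.
have := size_ccS k; have := size_ccS k.+1.
have := size_ccS k.+2; have := size_ccS k.+3.
have := size_cuS k; have := size_hcS k.
have := size_hcS k.+1; have := size_hcS k.+2.
have := num_ccS k; have := num_ccS k.+1.
have := num_ccS k.+2; have := num_ccS k.+3.
have := num_cuS k; have := num_hcS k.
have := num_hcS k.+1; have := num_hcS k.+2.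
lia.
Qed.

(** * Asymptotics *)

From mathcomp Require Import all_classical all_reals all_analysis.
Import Order.TTheory GRing.Theory Num.Theory.
Import numFieldNormedType.Exports.
Local Open Scope classical_set_scope.
Local Open Scope ring_scope.

(** * Convergence for perturbed linear recurrences *)

Lemma cvg0_contraction (R : realType) (rho : R) (u w : nat -> R) :
  0 <= rho < 1 -> (forall n, 0 <= u n) ->
  (forall n, u n.+1 <= rho * u n + w n) ->
  w @ \oo --> (0 : R) -> u @ \oo --> (0 : R).
Proof.
move=> /andP[rho0 rho1] u0 uS w0; apply/cvgr0Pnorm_le => e e0.
(* The map [t -> rho * t + e / 2 * (1 - rho)] fixes [e / 2], so once [w] is below this bound, any
   excess of [u] over [e / 2] decays geometrically. *)
have e1 : 0 < e / 2 * (1 - rho) by rewrite mulr_gt0 ?divr_gt0 ?subr_gt0.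
have /cvgr0Pnorm_le/(_ _ e1)[N _ HN] := w0.
have nrho : `|rho| < 1 by rewrite ger0_norm.
have e2 : 0 < e / 2 by rewrite divr_gt0.
have /cvgr0Pnorm_le/(_ _ e2)[K _ HK] := cvg_geometric (u N) nrho.
have uN k : u (N + k)%N <= u N * rho ^+ k + e / 2.
  elim: k => [|k IH]; first by rewrite addn0 expr0 mulr1 lerDl ltW.
  rewrite addnS (le_trans (uS _)) //.
  have wk : w (N + k)%N <= e / 2 * (1 - rho).
    by rewrite (le_trans (ler_norm _)) // HN //= leq_addr.
  have := ler_wpM2l rho0 IH; rewrite exprS; lra.
exists (N + K)%N => // n /= hn; rewrite ger0_norm //.
have Nn : (N <= n)%N by rewrite (leq_trans _ hn) ?leq_addr.
rewrite -(subnKC Nn) (le_trans (uN _)) //.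
have := HK (n - N)%N; rewrite /= leq_subRL // => /(_ hn) /(le_trans (ler_norm _)).
rewrite /geometric /=; lra.
Qed.

(* The weight [theta] makes [`|z n.+1| + theta * `|z n|] contract by the factor
   [(1 + `|p| + `|q|) / 2]. *)
Lemma cvg_second_order (R : realType) (p q e : R) (y : nat -> R) :
  `|p| + `|q| < 1 ->
  (fun n => y n.+2 - p * y n.+1 - q * y n) @ \oo --> e ->
  y @ \oo --> e / (1 - p - q).
Proof.
move=> pq cv; set L := e / _.
have pq0 : 1 - p - q != 0.
  rewrite gt_eqF //; have := ler_norm p; have := ler_norm q; lra.
have LE : L * (1 - p - q) = e by rewrite /L divfK.
pose theta : R := (1 + `|q| - `|p|) / 2.
pose rho : R := (1 + `|p| + `|q|) / 2.
have p0 := normr_ge0 p; have q0 := normr_ge0 q.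
have th0 : 0 <= theta by rewrite /theta; lra.
(* As [theta = rho - |p|], the coefficient of [|z n.+1|] is exactly [rho]; this inequality handles
   that of [|z n|]. Four times the gap is [(1 - |q|)^2 - |p|^2]. *)
have thr : `|q| <= theta * rho.
  have : 0 <= (1 - `|q| - `|p|) * (1 - `|q| + `|p|) by apply: mulr_ge0; lra.
  rewrite /theta /rho; lra.
pose z n := y n - L.
have zc : (fun n => `|z n.+1| + theta * `|z n|) @ \oo --> (0 : R).
  apply: (@cvg0_contraction _ rho _
    (fun n => `|y n.+2 - p * y n.+1 - q * y n - e|)).
  - by rewrite /rho; apply/andP; split; lra.
  - by move=> n; rewrite addr_ge0 // mulr_ge0.
  - move=> n; have zS : z n.+2 = p * z n.+1 + q * z n
        + (y n.+2 - p * y n.+1 - q * y n - e).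
      by rewrite -LE /z; ring.
    have le1 := ler_normD (p * z n.+1 + q * z n)
      (y n.+2 - p * y n.+1 - q * y n - e).
    have le2 := ler_normD (p * z n.+1) (q * z n).
    rewrite -zS in le1; rewrite !normrM in le2.
    have := ler_wpM2r (normr_ge0 (z n)) thr.
    have -> : rho * (`|z n.+1| + theta * `|z n|)
      = `|p| * `|z n.+1| + theta * `|z n.+1| + theta * rho * `|z n|.
      by rewrite /rho /theta; field.
    lra.
  - have := cvg_norm (cvgB cv (@cvg_cst _ e _ \oo _)).
    by rewrite subrr normr0; apply.
have zS : (fun n => `|z n.+1|) @ \oo --> (0 : R).
  apply: (@squeeze_cvgr _ _ _ _ (fun=> 0)
    (fun n => `|z n.+1| + theta * `|z n|)) => //.
    by near=> n; rewrite normr_ge0 /= lerDl mulr_ge0.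
  exact: cvg_cst.
have z0 : z @ \oo --> (0 : R) by apply: norm_cvg0; rewrite -cvg_shiftS.
have -> : y = (fun n => z n + L) by apply/funext => n; rewrite /z subrK.
by rewrite -[X in _ --> X]add0r; apply: cvgD => //; exact: cvg_cst.
Unshelve. all: by end_near. Qed.

(** * Growth rates at the dominant root *)

Section DominantRoot.
Variables (R : realType) (r : R).
Hypotheses (r_gt2 : 2 < r) (r_lt : r < 5 / 2).
(** [P] factors as [(z^2 - z + 1) (z^3 - z^2 - 2 z - 1)], and [r] is a root of the cubic. *)
Hypothesis r_cubic : r ^+ 3 = r ^+ 2 + 2 * r + 1.

(* The quotient of z^5 - 2 z^4 - z - 1 by z - r, applied to the shift; it is
   (z^2 - z + 1) (z^2 + (r - 1) z + (r^2 - r - 2)), with roots in the closed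
   unit disc. *)
Definition quotient_shift (u : nat -> R) (n : nat) : R :=
  u n.+4 + (r - 2) * u n.+3 + (r ^+ 2 - 2 * r) * u n.+2
  + (1 + 2 * r - r ^+ 2) * u n.+1 + (r ^+ 2 - r - 2) * u n.

Let r_gt0 : 0 < r. Proof. exact: lt_trans r_gt2. Qed.
Let r_neq0 : r != 0. Proof. by rewrite gt_eqF. Qed.
Let rX_neq0 n : r ^+ n != 0. Proof. by rewrite expf_neq0. Qed.

(** After division by [r ^+ n], each quadratic factor of the quotient is a second-order recurrence
    to which [cvg_second_order] applies. *)
Lemma cvg_quotient_shift (u : nat -> R) (e : R) :
  (fun n => quotient_shift u n / r ^+ n) @ \oo --> e ->
  (fun n => u n / r ^+ n) @ \oo --> e * r / (2 * r ^+ 4 + 4 * r + 5).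
Proof.
have [r2 r5] := (r_gt2, r_lt).
move=> cv; pose y n := (u n.+2 + (r - 1) * u n.+1 + (r ^+ 2 - r - 2) * u n) / r ^+ n.
have ycv : y @ \oo --> (e / r ^+ 2) / (1 - r^-1 - (- (r ^+ 2)^-1)).
  apply: cvg_second_order.
    rewrite normrN !ger0_norm ?invr_ge0 ?exprn_ge0 ?ltW //.
    have -> : r^-1 + (r ^+ 2)^-1 = (r + 1) / r ^+ 2 by field.
    by rewrite ltr_pdivrMr ?exprn_gt0 //; nra.
  have -> : (fun n => y n.+2 - r^-1 * y n.+1 - - (r ^+ 2)^-1 * y n)
    = (fun n => quotient_shift u n / r ^+ n / r ^+ 2).
    apply/funext => n; rewrite /y /quotient_shift !exprS.
    by field; rewrite r_neq0 rX_neq0.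
  by apply: cvgM => //; exact: cvg_cst.
have xcv := @cvg_second_order R (- (r - 1) / r) (- (r ^+ 2 - r - 2) / r ^+ 2)
  ((e / r ^+ 2) / (1 - r^-1 - (- (r ^+ 2)^-1)) / r ^+ 2)
  (fun n => u n / r ^+ n).
have D1 : r ^+ 2 - r + 1 != 0 by rewrite gt_eqF //; nra.
have D2 : 3 * r ^+ 2 - 2 * r - 2 != 0 by rewrite gt_eqF //; nra.
have -> : e * r / (2 * r ^+ 4 + 4 * r + 5) =
   (e / r ^+ 2) / (1 - r^-1 - (- (r ^+ 2)^-1)) / r ^+ 2
   / (1 - - (r - 1) / r - - (r ^+ 2 - r - 2) / r ^+ 2).
  (* Modulo the cubic this is [r * Q(r)], with [Q(r)] the product of both quadratic factors at
     [r]. *)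
  have -> : 2 * r ^+ 4 + 4 * r + 5
    = r * ((r ^+ 2 - r + 1) * (3 * r ^+ 2 - 2 * r - 2))
      - (r ^+ 3 - (r ^+ 2 + 2 * r + 1)) * (3 * r ^+ 2 - 4 * r + 5) by ring.
  rewrite r_cubic subrr mul0r subr0.
  have -> : 1 - r^-1 - (- (r ^+ 2)^-1) = (r ^+ 2 - r + 1) / r ^+ 2 by field.
  have -> : 1 - - (r - 1) / r - - (r ^+ 2 - r - 2) / r ^+ 2
    = (3 * r ^+ 2 - 2 * r - 2) / r ^+ 2 by field.
  by field; rewrite r_neq0 D1 D2.
apply: xcv.
  (* The contraction condition amounts to [r^2 - 2 r - 2 < 0], which [r < 5 / 2] ensures. *)
  rewrite !mulNr !normrN !ger0_norm; last 2 first.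
  - by rewrite divr_ge0 //; nra.
  - by rewrite divr_ge0 //; lra.
  have -> : (r - 1) / r + (r ^+ 2 - r - 2) / r ^+ 2
    = (2 * r ^+ 2 - 2 * r - 2) / r ^+ 2 by field.
  by rewrite ltr_pdivrMr ?exprn_gt0 //; nra.
have -> : (fun n => u n.+2 / r ^+ n.+2 - - (r - 1) / r * (u n.+1 / r ^+ n.+1)
    - - (r ^+ 2 - r - 2) / r ^+ 2 * (u n / r ^+ n)) = (fun n => y n / r ^+ 2).
  apply/funext => n; rewrite /y !exprS.
  by field; rewrite r_neq0 rX_neq0.
by apply: cvgM => //; exact: cvg_cst.
Qed.

Let a n : R := (num_cc n)%:R.
Let b n : R := (size_cc n)%:R.

(** [(S - r) Q(S) a = P(S) a = 0], so [Q(S) a] is geometric with ratio [r]. *)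
Lemma quotient_shift_num n :
  quotient_shift a n = quotient_shift a 0 * r ^+ n.
Proof.
elim: n => [|n IH]; first by rewrite mulr1.
rewrite exprS mulrCA -IH /quotient_shift /a num_cc_rec !natrD.
set a4 := (num_cc n.+4)%:R; set a3 := (num_cc n.+3)%:R.
set a2 := (num_cc n.+2)%:R; set a1 := (num_cc n.+1)%:R; set a0 := (num_cc n)%:R.
apply/eqP; rewrite -subr_eq0; apply/eqP.
transitivity ((r ^+ 3 - (r ^+ 2 + 2 * r + 1)) * (a1 - a2 - a0)); first by ring.
by rewrite r_cubic subrr mul0r.
Qed.

(** This makes the limit of [a n / r ^+ n] positive, so that one can divide by it. *)
Lemma quotient_shift_num0 : 0 < quotient_shift a 0.
Proof.
have r2 := r_gt2; have [c0 c1 u0 u1 h0] := num_init.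
have c2 := num_ccS 0; have c3 := num_ccS 1; have c4 := num_ccS 2.
have h1 := num_hcS 0; have h2 := num_hcS 1.
have [E2 E3 E4] : [/\ num_cc 2 = 2%N, num_cc 3 = 5%N & num_cc 4 = 11%N].
  by split; lia.
by rewrite /quotient_shift /a E2 E3 E4 c0 c1; nra.
Qed.

(** Composing [S - r] with the quotient gives [P(S) b], hence the forcing term. *)
Lemma quotient_shift_size n :
  quotient_shift (fun k => b k.+1 - r * b k) n
  = 2 * a n.+4 - a n.+2 + 3 * a n.+1 + 4 * a n.
Proof.
have /(congr1 (fun k => k%:R : R)) := size_cc_rec n.
rewrite !natrD -![(size_cc _)%:R]/(b _) -![(num_cc _)%:R]/(a _).
move=> /(canRL (addrK _)) E; rewrite /quotient_shift E.
apply/eqP; rewrite -subr_eq0; apply/eqP.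
transitivity ((r ^+ 3 - (r ^+ 2 + 2 * r + 1)) * (b n.+1 - b n.+2 - b n)); first by ring.
by rewrite r_cubic subrr mul0r.
Qed.

Lemma cvg_avgI_ladder :
  (fun n : nat => avgI R (ladder n)) @ \oo -->
    (2 * r ^+ 4 - r ^+ 2 + 3 * r + 4) / (2 * r ^+ 4 + 4 * r + 5).
Proof.
set D := 2 * r ^+ 4 + 4 * r + 5; set E := 2 * r ^+ 4 - _ + _ + _.
have D0 : 0 < D by rewrite !addr_gt0 ?mulr_gt0 ?exprn_gt0.
pose c := quotient_shift a 0 * r / D.
have c_gt0 : 0 < c by rewrite divr_gt0 ?mulr_gt0 ?quotient_shift_num0.
have acv : (fun n => a n / r ^+ n) @ \oo --> c.
  apply: cvg_quotient_shift.
  rewrite (_ : (fun n => _) = fun=> quotient_shift a 0); first exact: cvg_cst.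
  by apply/funext => n; rewrite quotient_shift_num mulfK.
have ashift k : (fun n => a (n + k)%N / r ^+ n) @ \oo --> c * r ^+ k.
  rewrite (_ : (fun n => _) = fun n => a (n + k)%N / r ^+ (n + k) * r ^+ k).
    apply: cvgM; last exact: cvg_cst.
    by rewrite (cvg_shiftn k (fun n => a n / r ^+ n)).
  by apply/funext => n; rewrite exprD; field; rewrite !rX_neq0.
pose x n := b n / r ^+ n.
have xcv : telescope x @ \oo --> c * E / D.
  have -> : telescope x = (fun n => (b n.+1 - r * b n) / r ^+ n / r).
    apply/funext => n; rewrite /telescope /= /x exprS.
    by field; rewrite r_neq0 rX_neq0.
  rewrite (_ : c * E / D = c * E * r / D / r); last first.
    by field; rewrite r_neq0 gt_eqF.
  apply: cvgM; last exact: cvg_cst.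
  apply: (@cvg_quotient_shift (fun n => b n.+1 - r * b n)).
  rewrite (_ : (fun n => _) = fun n => 2 * (a (n + 4)%N / r ^+ n)
     - a (n + 2)%N / r ^+ n + 3 * (a (n + 1)%N / r ^+ n)
     + 4 * (a (n + 0)%N / r ^+ n)).
    rewrite (_ : c * E = 2 * (c * r ^+ 4) - c * r ^+ 2 + 3 * (c * r ^+ 1)
      + 4 * (c * r ^+ 0)); last by rewrite /E; ring.
    apply: cvgD; last by apply: cvgM; [exact: cvg_cst | exact: ashift].
    apply: cvgD; last by apply: cvgM; [exact: cvg_cst | exact: ashift].
    apply: cvgB; last exact: ashift.
    by apply: cvgM; [exact: cvg_cst | exact: ashift].
  apply/funext => n; rewrite quotient_shift_size !addnS !addn0.
  by field; rewrite rX_neq0.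
have b0 : b 0 = 0 by rewrite /b /size_cc /size_states accept_sum0.
have := cesaro xcv; rewrite /arithmetic_mean telescopeK /= => mcv.
(* The shift avoids [n = 0], where [avgI] takes its conventional value. *)
rewrite -cvg_shiftS.
rewrite (_ : E / D = c * E / D / c); last first.
  by field; rewrite !gt_eqF.
rewrite (_ : [sequence _]_n = fun n =>
   (n.+1%:R^-1 * (x n.+1 - x 0)) / (a n.+1 / r ^+ n.+1)).
  apply: cvgM => //; apply: cvgV; first by rewrite gt_eqF.
  by rewrite (cvg_shiftS (fun n => a n / r ^+ n)).
apply/funext => n; rewrite /= /avgI nu_ladder /= T0_ladder T1_ladder.
rewrite /x b0 mul0r subr0 -/(a _) -/(b _) !invfM invrK.
have N0 : n.+1%:R != 0 :> R by rewrite pnatr_eq0.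
move: (a n.+1)^-1 (n.+1%:R) N0 => ia N N0.
by field; rewrite N0 rX_neq0.
Qed.
End DominantRoot.

(** * The dominant root in radicals *)

Theorem theorem9 (R : realType) :
  let r : R := 3^-1 * (1 + ((47 + 3 * Num.sqrt 93) / 2) `^ 3^-1
                         + ((47 - 3 * Num.sqrt 93) / 2) `^ 3^-1) in
  (fun n : nat => avgI R (ladder n)) @ \oo -->
    (2 * r ^+ 4 - r ^+ 2 + 3 * r + 4) / (2 * r ^+ 4 + 4 * r + 5).
Proof.
move=> r; set s := Num.sqrt 93 in r *.
have s0 : 0 <= s by exact: sqrtr_ge0.
have s2 : s ^+ 2 = 93 by rewrite sqr_sqrtr.
have s10 : s < 10 by nra.
set x := (47 + 3 * s) / 2 in r *; set y := (47 - 3 * s) / 2 in r *.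
have x0 : 0 <= x by rewrite /x; lra.
have y0 : 0 <= y by rewrite /y; lra.
have cube (z : R) : 0 <= z -> (z `^ 3^-1) ^+ 3 = z.
  by move=> z0; rewrite -powR_mulrn ?powR_ge0 // -powRrM mulVf // powRr1.
have := cube x x0; have := cube y y0.
have := powR_ge0 x 3^-1; have := powR_ge0 y 3^-1.
rewrite {}/r; move: (x `^ 3^-1) (y `^ 3^-1) => a b b0 a0 b3 a3.
(* Cardano: [a * b] is the cube root of [x * y = 343]. *)
have ab : a * b = 7.
  apply/eqP; rewrite -(@eqrXn2 _ 3) ?mulr_ge0 //.
  rewrite exprMn a3 b3 (_ : x * y = (47 ^+ 2 - 9 * s ^+ 2) / 4); last first.
    by rewrite /x /y; field.
  by rewrite s2; apply/eqP; field.
set r := 3^-1 * _.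
have r_cubic : r ^+ 3 = r ^+ 2 + 2 * r + 1.
  (* With [t = a + b] and [3 r = 1 + t] the cubic becomes [t^3 = 21 t + 47], which holds by
     [a * b = 7] and [x + y = 47]. *)
  have -> : r ^+ 3 = r ^+ 2 + 2 * r + 1
     + (a ^+ 3 + b ^+ 3 - 47 + (3 * (a * b) - 21) * (a + b)) / 27.
    by rewrite /r; field.
  by rewrite ab a3 b3 /x /y; field.
have r0 : 0 < r by rewrite /r; lra.
(* [z^3 - z^2 - 2 z - 1] is negative on [(0, 2]] and positive from [5 / 2] on, which locates [r]. *)
by apply: cvg_avgI_ladder => //; nra.
Qed.
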